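(* For every positive integer $t\le 22$, every graph $G$ on $4t-1$ vertices with $\alpha(G)=2$ satisfies $\mathrm{cm}(G)\ge t$.
   Context: All graphs are finite and simple. $\alpha(G)$ is the independence number. A matching $M$ in $G$ is connected if for every two edges of $M$ there is an edge of $G$ joining an endpoint of one to an endpoint of the other; $\mathrm{cm}(G)$ is the maximum size of a connected matching in $G$. *)

(* Defs.v *)
From mathcomp Require Import all_boot.
Set Implicit Arguments. Unset Strict Implicit. Unset Printing Implicit Defensive.

Definition simple_graph (T : finType) (g : rel T) : Prop :=
  symmetric g /\ irreflexive g.

Definition independent (T : finType) (g : rel T) (S : {set T}) : bool :=
  [forall x in S, forall y in S, ~~ g x y].

Definition alpha (T : finType) (g : rel T) : nat :=
  \max_(S : {set T} | independent g S) #|S|.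

Definition is_edge (T : finType) (g : rel T) (e : {set T}) : bool :=
  [exists x, exists y, (e == [set x; y]) && g x y].

Definition matching (T : finType) (g : rel T) (M : {set {set T}}) : bool :=
  [forall e in M, is_edge g e] &&
  [forall e in M, forall f in M, (e != f) ==> [disjoint e & f]].

Definition connected_matching (T : finType) (g : rel T) (M : {set {set T}}) : bool :=
  matching g M &&
  [forall e in M, forall f in M,
     (e != f) ==> [exists x in e, exists y in f, g x y]].

Definition cm (T : finType) (g : rel T) : nat :=
  \max_(M : {set {set T}} | connected_matching g M) #|M|.

(* Main.v *)
(** Let H be the complement of G; it is triangle-free, so H-neighbourhoods are
    cliques of G. Induct on t, over the vertex subsets X with |X| >= 4t - 1.

    If two G-adjacent vertices u, w have at most two common H-neighbours, delete
    u, w and these neighbours, and add the edge uw to a connected matching of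
    size t - 1 of the rest. So assume that all H-codegrees are at least 3. Let v
    have maximum H-degree D, and let A be its H-neighbourhood. Edges of G leaving
    distinct vertices of a clique are pairwise joined, so for D >= t a greedy
    matching out of t vertices of A works.

    For D < t, put k = t - D. Counting codegrees with v gives w in A of H-degree
    at least k; take k of its H-neighbours as a second clique C. A vertex outside
    A has at most D - 3 H-neighbours outside A, so the sets of common
    H-neighbours outside A of c in C and d outside A have total size at most
    (D - 3)(D - 4) as d varies. For t <= 22 the vertices of C can therefore be
    matched greedily to vertices d for which these sets altogether have at most
    2t - 1 - D elements. Matching A greedily to vertices outside all of these
    sets gives D further edges, each joined to all the edges at C. *)

Require Import Defs.
From mathcomp Require Import all_boot.
From mathcomp Require Import zify.

Set Implicit Arguments.
Unset Strict Implicit.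
Unset Printing Implicit Defensive.

(** * Cardinality bounds and greedy choice *)

Lemma leq_cardsD (T : finType) (A B : {set T}) : #|A| - #|B| <= #|A :\: B|.
Proof. rewrite cardsD leq_sub2l //; exact/subset_leq_card/subsetIr. Qed.

(** Fewer than [size s] values are taken whenever a new one is chosen, so every [F a] still has a
    free element. *)
Lemma greedy_representatives (T : finType) (s : seq T) (F : T -> {set T}) :
  (forall a, a \in s -> size s <= #|F a|) ->
  exists p : seq (T * T),
    [/\ unzip1 p = s, uniq (unzip2 p) & forall e, e \in p -> e.2 \in F e.1].
Proof.
elim: s => [|a s IHs] hF; first by exists [::].
have [|p [p1 p2 pF]] := IHs.
  by move=> b bs; apply/ltnW/hF; rewrite inE bs orbT.
have [b bF bp] : exists2 b, b \in F a & b \notin unzip2 p.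
  apply/subsetPn/negP => /subset_leq_card; rewrite leqNgt; case/negP.
  apply: leq_ltn_trans (card_size _) _.
  by rewrite size_map -(size_map fst) -/unzip1 p1; apply: hF; rewrite inE eqxx.
exists ((a, b) :: p); split; rewrite /= ?p1 ?bp //.
by move=> e; rewrite inE => /predU1P[-> //|/pF].
Qed.

(** * Connected matchings as lists of pairs *)

Definition joined (T : finType) (g : rel T) (e f : T * T) : bool :=
  [|| g e.1 f.1, g e.1 f.2, g e.2 f.1 | g e.2 f.2].

(** Ordered pairs allow the clique end of each edge to come first. A single [uniq] over all
    endpoints encodes disjointness, and [X] confines the matching so that the induction can delete
    vertices. *)
Definition cmseq (T : finType) (g : rel T) (X : {set T}) (s : seq (T * T)) :=
  [/\ {subset unzip1 s ++ unzip2 s <= X}, uniq (unzip1 s ++ unzip2 s),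
      {in s, forall e, g e.1 e.2} &
      {in s &, forall e f, e != f -> joined g e f}].

Lemma cat_cmseq (T : finType) (g : rel T) (X : {set T}) (s1 s2 : seq (T * T)) :
  symmetric g -> cmseq g X s1 -> cmseq g X s2 ->
  ~~ has (mem (unzip1 s1 ++ unzip2 s1)) (unzip1 s2 ++ unzip2 s2) ->
  {in s1 & s2, forall e f, joined g e f} -> cmseq g X (s1 ++ s2).
Proof.
move=> gC [sX1 u1 e1 j1] [sX2 u2 e2 j2] dis j12.
have pe : perm_eq (unzip1 (s1 ++ s2) ++ unzip2 (s1 ++ s2))
                  ((unzip1 s1 ++ unzip2 s1) ++ (unzip1 s2 ++ unzip2 s2)).
  by rewrite /unzip1 /unzip2 !map_cat perm_catACA.
split.
- move=> x; rewrite (perm_mem pe) mem_cat => /orP[/sX1|/sX2] //.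
- by rewrite (perm_uniq pe) cat_uniq u1 u2 dis.
- by move=> e; rewrite mem_cat => /orP[/e1|/e2].
- move=> e f; rewrite !mem_cat => /orP[es|es] /orP[fs|fs] ef.
  + exact: j1.
  + exact: j12.
  + have := j12 _ _ fs es; rewrite /joined !(gC f.1) !(gC f.2).
    by case/or4P => ->; rewrite ?orbT.
  + exact: j2.
Qed.

Lemma uniq_map_inj (T1 T2 : eqType) (f : T1 -> T2) (s : seq T1) :
  uniq (map f s) -> {in s &, injective f}.
Proof.
elim: s => [|z s IHs] //= /andP[zs us] x y.
rewrite !inE => /predU1P[->|xs] /predU1P[->|ys] //; last exact: IHs.
  by move=> fzy; rewrite fzy map_f in zs.
by move=> fxz; rewrite -fxz map_f in zs.
Qed.

(** Pairs of [s] that share a vertex are equal ([meetE]), so sending a pair to its set of endpoints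
    is injective and yields disjoint edges. *)
Lemma cmseq_cm (T : finType) (g : rel T) (X : {set T}) (s : seq (T * T)) :
  cmseq g X s -> size s <= cm g.
Proof.
move=> [_ us es js].
have /and3P[u1 /hasPn dis u2] :
  [&& uniq (unzip1 s), ~~ has (mem (unzip1 s)) (unzip2 s) & uniq (unzip2 s)].
  by rewrite -cat_uniq.
pose E (e : T * T) := [set e.1; e.2].
have meetE : {in s &, forall e f x, x \in E e -> x \in E f -> e = f}.
  have ne12 e f : e \in s -> f \in s -> e.1 <> f.2.
    by move=> es' fs ef; case/negP: (dis _ (map_f snd fs)); rewrite /= -ef; apply: map_f.
  move=> e f es' fs x; rewrite !inE => /orP[]/eqP-> /orP[]/eqP eq_ef.
  - exact: (uniq_map_inj u1).
  - by case: (ne12 e f).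
  - by case: (ne12 f e).
  - exact: (uniq_map_inj u2).
have injE : {in s &, injective E}.
  by move=> e f es' fs Eef; apply: (meetE _ _ es' fs e.1); rewrite -?Eef !inE eqxx.
have cardM : #|[set:: map E s]| = size s.
  rewrite cardsE -(size_map E); apply/card_uniqP.
  by rewrite map_inj_in_uniq // (map_uniq u1).
rewrite -cardM; apply: (leq_bigmax_cond (F := fun M : {set {set T}} => #|M|)).
apply/andP; split; first (apply/andP; split).
- apply/forall_inP => S; rewrite inE => /mapP[e es' ->{S}].
  by apply/existsP; exists e.1; apply/existsP; exists e.2; rewrite eqxx es.
- apply/forall_inP => S; rewrite inE => /mapP[e es' ->{S}].
  apply/forall_inP => S; rewrite inE => /mapP[f fs ->{S}].
  apply/implyP; apply: contraR => /pred0Pn[x /andP[/= xe xf]].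
  by rewrite (meetE _ _ es' fs x).
- apply/forall_inP => S; rewrite inE => /mapP[e es' ->{S}].
  apply/forall_inP => S; rewrite inE => /mapP[f fs ->{S}].
  apply/implyP => Eef; have : joined g e f.
    by apply: js => //; apply: contraNneq Eef => ->.
  by case/or4P => gef; apply/existsP; [exists e.1|exists e.1|exists e.2|exists e.2];
     rewrite !inE eqxx ?orbT /=; apply/existsP;
     [exists f.1|exists f.2|exists f.1|exists f.2]; rewrite !inE eqxx ?orbT.
Qed.

(** * The complement graph H *)

Definition nonadj (T : finType) (g : rel T) (x y : T) := (x != y) && ~~ g x y.

Definition non_nbrs (T : finType) (g : rel T) (X : {set T}) (x : T) : {set T} :=
  [set y in X | nonadj g x y].

(** Triangle-freeness of H, whose edge relation is [nonadj]. *)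
Definition no_indep3 (T : finType) (g : rel T) :=
  forall x y z, nonadj g x y -> nonadj g y z -> nonadj g x z -> False.

Lemma nonadjC (T : finType) (g : rel T) : symmetric g -> symmetric (nonadj g).
Proof. by move=> gC x y; rewrite /nonadj eq_sym gC. Qed.

Lemma adjP (T : finType) (g : rel T) (x y : T) :
  x != y -> ~~ nonadj g x y -> g x y.
Proof. by move=> xy; rewrite /nonadj xy negbK. Qed.

Lemma alpha2_no_indep3 (T : finType) (g : rel T) :
  simple_graph g -> alpha g = 2 -> no_indep3 g.
Proof.
move=> [gC g0] a2 x y z /andP[xy gxy] /andP[yz gyz] /andP[xz gxz].
have : #|[set x; y; z]| <= alpha g.
  apply: (leq_bigmax_cond (F := fun S : {set T} => #|S|)).
  apply/forall_inP => u uS; apply/forall_inP => w.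
  move: uS; rewrite !inE => /orP[/orP[]|] /eqP-> /orP[/orP[]|] /eqP->;
  by rewrite ?g0 // gC.
by rewrite a2 -setUA cardsU1 cards2 !inE negb_or xy xz yz.
Qed.

(** Any two of the edges are joined through their first ends, which lie in the clique [K]; only the
    distinctness of the second ends has to be arranged, and greedy choice does that. *)
Lemma clique_cmseq (T : finType) (g : rel T) (X : {set T}) (K : seq T)
    (F : T -> {set T}) :
  symmetric g -> uniq K -> {subset K <= X} ->
  {in K &, forall a b, a != b -> g a b} ->
  (forall a, a \in K -> forall b, b \in F a -> [/\ b \in X, b \notin K & g a b]) ->
  (forall a, a \in K -> size K <= #|F a|) ->
  exists s, [/\ cmseq g X s, unzip1 s = K & forall e, e \in s -> e.2 \in F e.1].
Proof.
move=> gC uK KX Kg FP hF; have [s [s1 s2 sF]] := greedy_representatives hF.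
have sK e : e \in s -> e.1 \in K by move=> es; rewrite -s1 map_f.
have s2P b : b \in unzip2 s -> b \in X /\ b \notin K.
  by case/mapP=> e es ->; have [] := FP _ (sK _ es) _ (sF _ es).
exists s; split => //; split.
- by move=> x; rewrite s1 mem_cat => /orP[/KX|/s2P[]].
- by rewrite cat_uniq s1 uK s2 andbT; apply/hasPn => b /s2P[].
- by move=> e es; have [] := FP _ (sK _ es) _ (sF _ es).
- move=> e f es fs ef; apply/or4P; apply: Or41; apply: Kg; rewrite ?sK //.
  apply: contraNneq ef => ef1; apply/eqP/(uniq_map_inj _ es fs ef1).
  by rewrite -/unzip1 s1.
Qed.

(** * Double counting and unions over lists *)

Lemma double_count (T : finType) (r : rel T) (Q R : {set T}) : symmetric r ->
  \sum_(d in Q) #|[set u in R | r d u]| = \sum_(u in R) #|[set d in Q | r u d]|.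
Proof.
move=> rC.
have cardE (A : {set T}) x : #|[set y in A | r x y]| = \sum_(y in A) r x y.
  rewrite -sum1_card big_mkcond [RHS]big_mkcond; apply: eq_bigr => y _.
  by rewrite inE; case: (y \in A) => //=; case: (r x y).
under eq_bigr do rewrite cardE; under [RHS]eq_bigr do rewrite cardE.
by rewrite exchange_big; apply: eq_bigr => u _; apply: eq_bigr => d _; rewrite rC.
Qed.

Lemma card_bigcup_seq (I : eqType) (T : finType) (s : seq I) (F : I -> {set T}) m :
  {in s, forall i, #|F i| <= m} -> #|\bigcup_(i <- s) F i| <= size s * m.
Proof.
elim: s => [|i s IHs] Fm; first by rewrite big_nil cards0.
rewrite big_cons mulSn; apply: leq_trans (leq_card_setU _ _) _.
by rewrite leq_add ?Fm ?mem_head // IHs // => j js; rewrite Fm // inE js orbT.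
Qed.

Lemma mem_bigcup_seq (I : eqType) (T : finType) (s : seq I) (F : I -> {set T}) i x :
  i \in s -> x \in F i -> x \in \bigcup_(j <- s) F j.
Proof. by move=> js xF; rewrite (big_rem i js) inE xF. Qed.

(** * Cliques from H-neighbourhoods; maximum H-degree at least t *)

Lemma non_nbrs_clique (T : finType) (g : rel T) (X : {set T}) (x : T) :
  symmetric g -> no_indep3 g ->
  {in non_nbrs g X x &, forall a b, a != b -> g a b}.
Proof.
move=> gC g3 a b; rewrite !inE => /andP[_ xa] /andP[_ xb] ab.
by apply: adjP ab _; apply/negP => /(g3 x a b xa); apply.
Qed.

Lemma large_degree (T : finType) (g : rel T) (X : {set T}) (v : T) (t : nat) :
  symmetric g -> no_indep3 g -> 4 * t - 1 <= #|X| ->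
  {in X, forall x, #|non_nbrs g X x| <= #|non_nbrs g X v|} ->
  t <= #|non_nbrs g X v| -> exists s, cmseq g X s /\ size s = t.
Proof.
move=> gC g3 hX maxv /card_geqP[K [uK sK KN]].
have KX : {subset K <= X} by move=> x /KN; rewrite inE => /andP[].
have Kg : {in K &, forall a b, a != b -> g a b}.
  by move=> a b /KN aN /KN bN; apply: non_nbrs_clique bN.
have cK : #|[set x in K]| <= t by rewrite cardsE -sK card_size.
pose F a := X :\: [set x in K] :\: (a |: non_nbrs g X a).
have FP a : a \in K -> forall b, b \in F a -> [/\ b \in X, b \notin K & g a b].
  move=> aK b; rewrite !inE negb_or => /and3P[/andP[ba nab] bK bX].
  by split=> //; apply: adjP; [rewrite eq_sym | rewrite bX in nab].
have hF a : a \in K -> size K <= #|F a|.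
  move=> aK; rewrite sK.
  (* If the maximum H-degree is below 2t, at least (4t - 1) - t - (2t - 1) = t candidates survive.
     Otherwise the clique [non_nbrs g X v] has t vertices outside [K], all adjacent to [a]. *)
  have [small|big] := ltnP #|non_nbrs g X v| (2 * t).
    (* The count has no slack: [a] must not be subtracted again, being already in [K]. *)
    have FE : F a = X :\: [set x in K] :\: non_nbrs g X a.
      apply/setP => b; rewrite !inE; case: eqVneq => [->|//].
      by rewrite aK /= andbF.
    rewrite FE.
    have := leq_cardsD (X :\: [set x in K]) (non_nbrs g X a).
    by have := leq_cardsD X [set x in K]; have := maxv _ (KX _ aK); lia.
  apply: (@leq_trans #|non_nbrs g X v :\: [set x in K]|).
    by have := leq_cardsD (non_nbrs g X v) [set x in K]; lia.
  apply/subset_leq_card/subsetP => b /setDP[bN]; rewrite inE => bK.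
  have bX : b \in X by move: bN; rewrite inE => /andP[].
  have ab : a != b by apply: contraNneq bK => <-.
  rewrite !inE bK bX eq_sym negb_or ab /= andbT.
  by rewrite /nonadj negb_and (non_nbrs_clique gC g3 (KN _ aK) bN ab) orbT.
have [s [cs s1 _]] := clique_cmseq gC uK KX Kg FP hF.
by exists s; split=> //; rewrite -sK -s1 size_map.
Qed.

(** * Numerical inequalities for t at most 22, checked by computation *)

Lemma forall_iota2 (P : nat -> nat -> bool) n :
  all (fun t => all (P t) (iota 0 t)) (iota 0 n.+1) ->
  forall t D, t <= n -> D < t -> P t D.
Proof.
move=> /allP H t D tn Dt.
have ti : t \in iota 0 n.+1 by rewrite mem_iota.
by have /allP := H t ti; apply; rewrite mem_iota.
Qed.

(** Contradicts the double count of H-edges between the clique A and the rest when every vertex of A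
    has H-degree below t - D. *)
Lemma numeric_degree t D : 0 < t <= 22 -> D < t ->
  D * (t - D - 2) < 3 * (4 * t - 2 - D).
Proof.
case/andP=> _; move: t D; apply: forall_iota2; by vm_compute.
Qed.

(* [q] counts the vertices [d] with too many common non-neighbours with [c]. *)
Lemma numeric_candidates t D q : t <= 22 -> D < t ->
  q * ((2 * t - 1 - D) %/ (t - D)).+1 <= (D - 3) * (D - 4) ->
  t - D + q <= 4 * t - 1 - D - (t - D) - (D - 3).
Proof.
move=> t22 Dt; rewrite -leq_divRL // => hq.
have : t - D + (D - 3) * (D - 4) %/ ((2 * t - 1 - D) %/ (t - D)).+1
       <= 4 * t - 1 - D - (t - D) - (D - 3).
  move: t D t22 Dt {hq}; apply: forall_iota2; by vm_compute.
by apply: leq_trans; rewrite leq_add2l.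
Qed.

(** * Maximum H-degree below t: two cliques *)

Lemma small_degree (T : finType) (g : rel T) (X : {set T}) (v : T) (t : nat) :
  symmetric g -> no_indep3 g -> 0 < t <= 22 -> 4 * t - 1 <= #|X| -> v \in X ->
  {in X, forall x, #|non_nbrs g X x| <= #|non_nbrs g X v|} ->
  {in X &, forall x y, x != y -> g x y ->
    2 < #|non_nbrs g X x :&: non_nbrs g X y|} ->
  #|non_nbrs g X v| < t -> exists s, cmseq g X s /\ size s = t.
Proof.
move=> gC g3 t22 hX vX; set N := non_nbrs g X => maxv codeg.
have nC := nonadjC gC.
have NP x y : (y \in N x) = (y \in X) && nonadj g x y by rewrite inE.
set A := N v; set D := #|A| => Dt; set k := t - D.
have AX a : a \in A -> a \in X by rewrite NP => /andP[].
(* Such an [x] is adjacent to [v], so at least 3 of its at most [D] H-neighbours lie in [A]. *)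
have NAv x : x \in X -> x != v -> x \notin A -> #|N x :\: A| <= D - 3.
  move=> xX xv; rewrite NP xX /= => /(adjP _) vx.
  have := codeg x v xX vX xv; rewrite gC vx 1?eq_sym // => /(_ isT).
  by rewrite -/A cardsD; have := maxv _ xX; rewrite -/D -/A; lia.
have NA x : x \in X -> x \notin A -> #|N x :\: A| <= D - 3.
  move=> xX; have [->|xv] := eqVneq x v; last exact: NAv.
  by rewrite setDv cards0.
(* Otherwise count H-edges between [A] and [Q]: each [d] in [Q] has at least 3 H-neighbours in [A],
   while each [u] in [A] has at most [k - 2] in [Q], one of its at most [k - 1] being [v]. *)
have [w wA kw] : exists2 w, w \in A & k <= #|N w|.
  apply/exists_inP; apply: contraLR (numeric_degree t22 Dt).
  rewrite negb_exists_in -leqNgt => /forall_inP small.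
  pose Q := X :\: A :\ v.
  have : 3 * #|Q| <= \sum_(d in Q) #|[set u in A | nonadj g d u]|.
    rewrite mulnC -sum_nat_const; apply: leq_sum => d.
    rewrite in_setD1 in_setD => /and3P[dv dA dX].
    have gdv : g v d by apply: adjP; [rewrite eq_sym | rewrite NP dX in dA].
    apply: leq_trans (codeg v d vX dX _ gdv) _; first by rewrite eq_sym.
    apply/subset_leq_card/subsetP => u; rewrite in_setI inE => /andP[-> /=].
    by rewrite NP => /andP[].
  rewrite (double_count _ _ nC) => /leq_trans.
  move/(_ (D * (k - 2))) => H; apply: leq_trans (H _) => {H}.
    have cQ : #|X| - D - 1 <= #|Q|.
      have := leq_cardsD (X :\: A) [set v]; rewrite cards1.
      by have := leq_cardsD X A; rewrite -/D /Q; lia.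
    rewrite leq_mul2l /=; lia.
  rewrite -sum_nat_const; apply: leq_sum => u uA.
  have vu : v \in N u by move: uA; rewrite !NP vX nC => /andP[].
  have: #|N u :\ v| <= k - 2.
    by have := cardsD1 v (N u); rewrite vu; have := small _ uA; rewrite -ltnNge; lia.
  apply: leq_trans; apply/subset_leq_card/subsetP => d.
  rewrite inE !in_setD1 in_setD => /andP[/and3P[dv _ dX] ud].
  by rewrite dv NP dX ud.
have /card_geqP[C [uC sC CN]] := kw.
have CX : {subset C <= X} by move=> x /CN; rewrite NP => /andP[].
(* A common vertex would form an H-triangle with [v] and [w]. *)
have CA c : c \in C -> c \notin A.
  move/CN; rewrite NP => /andP[_ wc]; apply/negP; rewrite NP => /andP[_ vc].
  by move: wA; rewrite NP => /andP[_ vw]; apply: g3 vw wc vc.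
have Cg : {in C &, forall a b, a != b -> g a b}.
  by move=> a b /CN aN /CN bN; apply: non_nbrs_clique bN.
have cC : #|[set x in C]| <= k by rewrite cardsE -sC card_size.
(* The largest bound for which [k] sets of size at most [m] have total size at most
   [2 * t - 1 - D]. *)
pose m := (2 * t - 1 - D) %/ k.
pose Q c := X :\: A :\: [set x in C] :\: (N c :\: A).
pose W c d := (N c :&: N d) :\: A.
pose F c := [set d in Q c | #|W c d| <= m].
have QP c d : d \in Q c -> [/\ d \in X, d \notin A, d \notin C & ~~ nonadj g c d].
  by rewrite !inE; case: (d \in X); case: (_ \in C); case: (nonadj g v d);
     case: (nonadj g c d).
have FP c : c \in C -> forall d, d \in F c -> [/\ d \in X, d \notin C & g c d].
  move=> cC' d; rewrite inE => /andP[/QP[dX dA dC ncd] _]; split=> //.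
  by apply: adjP ncd; apply: contraNneq dC => <-.
have hF c : c \in C -> size C <= #|F c|.
  move=> cC'; rewrite sC.
  have cX := CX _ cC'; have cA := CA _ cC'; have cNA := NA _ cX cA.
  pose B := [set d in Q c | m < #|W c d|].
  have cQ : #|F c| + #|B| = #|Q c|.
    rewrite -cardsUI; set I := _ :&: _; have -> : I = set0.
      by apply/setP => d; rewrite !inE ltnNge; case: (_ <= m); rewrite ?andbF.
    rewrite cards0 addn0; apply: eq_card => d.
    by rewrite in_setU [d \in F c]inE [d \in B]inE -andb_orr ltnNge orbN andbT.
  have hB : #|B| * m.+1 <= (D - 3) * (D - 4).
    rewrite -sum_nat_const.
    apply: (@leq_trans (\sum_(d in B) #|[set u in N c :\: A | nonadj g d u]|)).
      apply: leq_sum => d; rewrite inE => /andP[_ /leq_trans]; apply.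
      apply/subset_leq_card/subsetP => u; rewrite in_setD in_setI => /and3P[uA uc].
      by rewrite NP => /andP[_ du]; rewrite inE in_setD uA uc.
    rewrite (double_count _ _ nC).
    apply: (@leq_trans (\sum_(u in N c :\: A) (D - 4))); last first.
      by rewrite sum_nat_const leq_mul2r cNA orbT.
    apply: leq_sum => u; rewrite in_setD NP => /and3P[uA uX cu].
    (* [c] is one of the at most [D - 3] H-neighbours of [u] outside [A] but is not in [B], which
       leaves [D - 4]. *)
    have cu' : c \in N u :\: A by rewrite in_setD cA NP cX nC.
    have : #|(N u :\: A) :\ c| <= D - 4.
      by have := NA _ uX uA; rewrite (cardsD1 c) cu'; clear; lia.
    apply: leq_trans; apply/subset_leq_card/subsetP => d.
    rewrite inE inE => /andP[/andP[/QP[dX dA dC _] _] ud].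
    rewrite in_setD1 in_setD dA NP dX ud !andbT.
    by apply: contraNneq dC => ->.
  have t22' : t <= 22 by case/andP: t22.
  have hQ : 4 * t - 1 - D - k - (D - 3) <= #|Q c|.
    apply: leq_trans (leq_cardsD _ _); apply: leq_sub cNA.
    apply: leq_trans (leq_cardsD _ _); apply: leq_sub cC.
    by apply: leq_trans (leq_cardsD _ _); rewrite leq_sub2r.
  have /leq_trans/(_ hQ) := numeric_candidates t22' Dt hB.
  by rewrite -cQ leq_add2r.
have [s2 [cs2 s21 s2F]] := clique_cmseq gC uC CX Cg FP hF.
have ss2 : size s2 = k by rewrite -sC -s21 size_map.
pose V2 := unzip1 s2 ++ unzip2 s2.
have V2A x : x \in V2 -> x \notin A.
  rewrite mem_cat s21 => /orP[/CA //|/mapP[e es ->]].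
  by have := s2F _ es; rewrite inE => /andP[/QP[]].
pose bad := \bigcup_(e <- s2) W e.1 e.2.
have cbad : #|bad| <= 2 * t - 1 - D.
  apply: leq_trans (_ : k * m <= _); last by rewrite mulnC leq_divM.
  rewrite -ss2; apply: card_bigcup_seq => e /s2F.
  by rewrite inE => /andP[].
pose G a := X :\: A :\: [set x in V2] :\: N a :\: bad.
have GP a : a \in enum A ->
    forall b, b \in G a -> [/\ b \in X, b \notin enum A & g a b].
  rewrite mem_enum => aA b; rewrite !in_setD mem_enum => /and5P[_ ba _ bA bX].
  split=> //; apply: adjP; last by rewrite NP bX in ba.
  by apply: contraNneq bA => <-.
have hG a : a \in enum A -> size (enum A) <= #|G a|.
  rewrite mem_enum -cardE -/D => aA.
  have cV2 : #|[set x in V2]| <= 2 * k.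
    rewrite cardsE; apply: leq_trans (card_size _) _.
    by rewrite size_cat !size_map ss2; lia.
  (* Exactly enough remains: (4t - 1) - D - 2k - D - (2t - 1 - D) = D, since k = t - D. *)
  have := leq_cardsD (X :\: A :\: [set x in V2] :\: N a) bad.
  have := leq_cardsD (X :\: A :\: [set x in V2]) (N a).
  have := leq_cardsD (X :\: A) [set x in V2].
  have := leq_cardsD X A; have := maxv _ (AX _ aA).
  rewrite -/(G a) -/A -/D /k in cV2 *; lia.
have [] := @clique_cmseq _ g X (enum A) G gC (enum_uniq _) _ _ GP hG.
- by move=> a; rewrite mem_enum; apply: AX.
- by move=> a b; rewrite !mem_enum; apply: non_nbrs_clique.
move=> s1 [cs1 s11 s1G]; exists (s1 ++ s2); split; last first.
  by rewrite size_cat ss2 -(size_map fst s1) -/(unzip1 s1) s11 -cardE -/D /k; lia.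
have s1A e : e \in s1 -> e.1 \in A by move=> es; rewrite -mem_enum -s11 map_f.
apply: cat_cmseq => //.
  rewrite -/V2; apply/hasPn => x xV2 /=; rewrite mem_cat negb_or s11 mem_enum V2A //=.
  by apply/mapP => -[e es ex]; have := s1G _ es; rewrite !in_setD -ex inE xV2 !andbF.
move=> e f es fs; have := s1G _ es; rewrite !in_setD inE.
set b := e.2 => /and5P[bbad _ bV2 bA bX].
have fV2 : (f.1 \in V2) && (f.2 \in V2) by rewrite !mem_cat !map_f ?orbT.
(* If [b] were adjacent to neither end of [f], it would be a common H-neighbour of both outside [A],
   hence in [bad]. *)
apply: contraNT bbad; rewrite /joined !negb_or => /and4P[_ _ gb1 gb2].
apply: mem_bigcup_seq fs _; rewrite in_setD bA in_setI !NP bX /= !(nC _ b).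
rewrite /nonadj gb1 gb2 !andbT; case/andP: fV2 => f1 f2.
by apply/andP; split; apply: contraNneq bV2 => ->.
Qed.

(** * Induction on t *)

Lemma cmseq_exists (T : finType) (g : rel T) (t : nat) (X : {set T}) :
  symmetric g -> no_indep3 g -> t <= 22 -> 4 * t - 1 <= #|X| ->
  exists s, cmseq g X s /\ size s = t.
Proof.
move=> gC g3; elim: t X => [|t IHt] X t22 hX; first by exists [::]; do !split.
pose N := non_nbrs g X.
have [/existsP[u /existsP[w /and5P[uX wX uw guw small]]]|none] := boolP
  [exists u, exists w, [&& u \in X, w \in X, u != w, g u w & #|N u :&: N w| <= 2]].
  (* At most 4 vertices go, matching the drop in 4t - 1. Every vertex of [Y] is adjacent to [u] or
     [w], so the edge [(u, w)] is joined to every edge inside [Y]. *)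
  pose Y := X :\: ([set u; w] :|: N u :&: N w).
  have [||s [cs ss]] := IHt Y; first exact: ltnW.
    have := leq_cardsD X ([set u; w] :|: N u :&: N w).
    have [cU _] := leq_card_setU [set u; w] (N u :&: N w).
    by move: cU; rewrite cards2 uw -/Y; lia.
  have YP x : x \in Y -> [/\ x \in X, x != u, x != w & g u x || g w x].
    rewrite !inE; case xX: (x \in X); rewrite ?andbF //= !andbT.
    rewrite !negb_or => /andP[/andP[xu xw] uwx]; split=> //.
    by move: uwx; rewrite /nonadj ![_ == x]eq_sym xu xw /= -negb_or negbK.
  case: cs => sY us es js; exists ([:: (u, w)] ++ s); split; last by rewrite /= ss.
  apply: cat_cmseq => //.
  - split=> //=.
    + by move=> x; rewrite !inE => /orP[]/eqP->.
    + by rewrite inE uw.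
    + by move=> e; rewrite inE => /eqP->.
    + by move=> e f; rewrite !inE => /eqP-> /eqP->; rewrite eqxx.
  - by split=> // x /sY /YP[].
  - apply/hasPn => x /sY /YP[_ xu xw _] /=.
    by rewrite !inE negb_or xu xw.
  - move=> e f; rewrite inE => /eqP-> fs; rewrite /joined /=.
    have /YP[_ _ _ ] : f.1 \in Y by rewrite sY // mem_cat map_f.
    by case/orP => ->; rewrite ?orbT.
have codeg : {in X &, forall x y, x != y -> g x y -> 2 < #|N x :&: N y|}.
  move=> x y xX yX xy gxy; rewrite ltnNge; apply: contraNN none => small.
  by apply/existsP; exists x; apply/existsP; exists y; apply/and5P.
have /card_gt0P[x0 x0X] : 0 < #|X| by lia.
pose v := [arg max_(x > x0 in X) #|N x|].
have [vX maxv] : v \in X /\ {in X, forall x, #|N x| <= #|N v|}.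
  by rewrite /v; case: arg_maxnP.
have [Dt|tD] := ltnP #|N v| t.+1; last exact: large_degree gC g3 hX maxv tD.
have t22' : 0 < t.+1 <= 22 by [].
exact: small_degree gC g3 t22' hX vX maxv codeg Dt.
Qed.

Theorem theorem1p6 (t : nat) (g : rel 'I_(4 * t - 1)) :
  0 < t -> t <= 22 ->
  simple_graph g -> alpha g = 2 -> t <= cm g.
Proof.
move=> _ t22 gS a2; have [gC _] := gS.
have [|s [cs ss]] := cmseq_exists (X := setT) gC (alpha2_no_indep3 gS a2) t22.
  by rewrite cardsT card_ord.
by have := cmseq_cm cs; rewrite ss.
Qed.
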